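(* Let $S$ be a finite nonempty set. A function $f:S^{\mathbb Z}\to S^{\mathbb Z}$ is a slider if and only if $f$ is a left-closing cellular automaton and $v_p(\lambda_f)\le 0$ for all primes $p$.
   Context: Configurations are elements $x\in S^{\mathbb Z}$ ($S$ finite), with the product topology; $\sigma(x)_i=x_{i+1}$ is the left shift. A cellular automaton (CA) is a continuous map $S^{\mathbb Z}\to S^{\mathbb Z}$ commuting with $\sigma$. $[i,j)$ denotes an interval of integers. Block rules and sliders. A block rule is a function $\chi:S^m\to S^m$ ($m\ge1$). For $i\in\mathbb Z$, $\chi^i:S^{\mathbb Z}\to S^{\mathbb Z}$ applies $\chi$ at coordinate $i$: $\chi^i(x)_{[i,i+m)}=\chi(x_{[i,i+m)})$, and all other coordinates are unchanged. Define $\chi^{i+}(x)=\lim_{j\to\infty}\chi^{j}\circ\chi^{j-1}\circ\cdots\circ\chi^{i}(x)$ and, for a block rule $\xi$, $\xi^{i-}(x)=\lim_{j\to-\infty}\xi^{j}\circ\cdots\circ\xi^{i-2}\circ\xi^{i-1}(x)$; these limits always exist. If $\chi$ is bijective with inverse $\xi$, its slider relation is the set $F\subset S^{\mathbb Z}\times S^{\mathbb Z}$ of pairs $(y,z)$ such that for some $x\in S^{\mathbb Z}$ and $i\in\mathbb Z$, $\xi^{i-}(x)=y$ and $\chi^{i+}(x)=z$. A function $f$ is a slider if it is (its graph is) the slider relation of some bijective block rule. Left-closing. A CA $f$ is left-closing if $f(y)\ne f(y')$ whenever $y\neq y'$ are configurations with $y_{[i,\infty)}=y'_{[i,\infty)}$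 for some $i\in\mathbb Z$. Right stairs. For a CA $f$ and a positive integer $m$, $\Psi_{3m}$ is the set of pairs $(v,w)\in S^{2m}\times S^{2m}$ for which there exists $x\in S^{\mathbb Z}$ with $x_{[m,3m)}=v$ and $f(x)_{[0,2m)}=w$. For a left-closing CA $f$, $$\lambda_f=\lim_{m\to\infty}\frac{|\Psi_{3m}|}{|S|^{3m}};$$ this limit exists and is reached for all sufficiently large $m$, so it is a positive rational number. For a prime $p$ and nonzero integer $n$, $v_p(n)$ is the largest $k$ with $p^k\mid n$; for a rational $r=m/n$, $v_p(r)=v_p(m)-v_p(n)$. *)

(* Defs.v *)
From HB Require Import structures.
From mathcomp Require Import all_boot all_order all_algebra.
From mathcomp Require Import all_classical all_reals all_analysis.

Set Implicit Arguments.
Unset Strict Implicit.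
Unset Printing Implicit Defensive.

Import Order.TTheory GRing.Theory Num.Theory.
Import numFieldNormedType.Exports.

Local Open Scope classical_set_scope.
Local Open Scope ring_scope.

Definition config (S : finType) : Type := {ptws int -> discrete_topology S}.

Definition shift (S : finType) (x : config S) : config S := fun i => x (i + 1).

Definition cellular_automaton (S : finType) (f : config S -> config S) : Prop :=
  continuous f /\ forall x, f (shift x) = shift (f x).

(* The word x_{[i, i + n)}. *)
Definition window (S : finType) (n : nat) (x : config S) (i : int) :
    n.-tuple S :=
  [tuple (x (i + (k : nat)%:Z) : S) | k < n].

Definition apply_at (S : finType) (m : nat) (chi : m.-tuple S -> m.-tuple S)
    (i : int) (x : config S) : config S :=
  fun k => if (i <= k) && (k < i + m%:Z)
           then nth (x k : S) (chi (window m x i)) `|k - i|%N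
           else x k.

(* chi^{i + n} \o ... \o chi^{i + 1} \o chi^i *)
Fixpoint right_sweep (S : finType) (m : nat) (chi : m.-tuple S -> m.-tuple S)
    (i : int) (n : nat) (x : config S) : config S :=
  if n is n'.+1 then apply_at chi (i + n%:Z) (right_sweep chi i n' x)
  else apply_at chi i x.

(* xi^{i - 1 - n} \o ... \o xi^{i - 2} \o xi^{i - 1} *)
Fixpoint left_sweep (S : finType) (m : nat) (xi : m.-tuple S -> m.-tuple S)
    (i : int) (n : nat) (x : config S) : config S :=
  if n is n'.+1 then apply_at xi (i - 1 - n%:Z) (left_sweep xi i n' x)
  else apply_at xi (i - 1) x.

(* The limits xi^{i-}(x) = y and chi^{i+}(x) = z are written as convergence:
   configurations form a Hausdorff space, so limits are unique, and [lim]
   would need a distinguished point of S. *)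
Definition slider_relation (S : finType) (m : nat)
    (chi xi : m.-tuple S -> m.-tuple S) (y z : config S) : Prop :=
  exists (x : config S) (i : int),
    ((fun n => left_sweep xi i n x) @ \oo --> y) /\
    ((fun n => right_sweep chi i n x) @ \oo --> z).

Definition slider (S : finType) (f : config S -> config S) : Prop :=
  exists (m : nat) (chi xi : m.-tuple S -> m.-tuple S),
    [/\ (1 <= m)%N, cancel chi xi, cancel xi chi
      & forall y z, slider_relation chi xi y z <-> z = f y].

Definition left_closing (S : finType) (f : config S -> config S) : Prop :=
  forall y y' : config S, y <> y' ->
    (exists i : int, forall k : int, i <= k -> y k = y' k) -> f y <> f y'.

(* Psi_{3m} *)
Definition right_stairs (S : finType) (f : config S -> config S) (m : nat) :
    {set (2 * m).-tuple S * (2 * m).-tuple S} :=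
  [set vw | `[< exists x : config S,
      window (2 * m) x m%:Z = vw.1 /\ window (2 * m) (f x) 0 = vw.2 >]].

Definition stair_density (S : finType) (f : config S -> config S) (m : nat) :
    rat :=
  #|right_stairs f m|%:R / (#|S| ^ (3 * m))%:R.

(* For a left-closing cellular automaton the sequence is eventually constant,
   so its limit may be taken in the rationals (rat^o carries the topology of
   the absolute value). *)
Definition lambda (S : finType) (f : config S -> config S) : rat :=
  lim ((stair_density f : nat -> rat^o) @ \oo).

(* Only meaningful for r != 0. *)
Definition padic_val (p : nat) (r : rat) : int :=
  (logn p `|numq r|%N)%:Z - (logn p `|denq r|%N)%:Z.

(* Main.v *)
(** A bijective block rule on d + 1 cells is a bijective transducer: in a state
   u of d cells it reads the letter y_(j + d), writes z_j and moves to a new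
   state, and slider pairs (y, z) are the input-output pairs of its bi-infinite
   runs. A past output, a present state and a future input can be chosen freely
   and determine the run.

   If the input-output relation is a function f, then f is local by
   compactness. If f were not left-closing, there would be two states with the
   same output for every future input, reached after the same output w but
   from different inputs; since reachability in a bijective transducer is
   symmetric, such sets of states could be enlarged without bound. Finally the
   number kappa of states at time j of runs over a given input y is constant in
   j and depends only on a window of y, hence does not depend on y; counting
   runs on a window gives |Psi_3m| kappa = |S|^(3m), so lambda_f = 1 / kappa.

   Conversely, if f is a left-closing automaton, x |-> (stair of x, x_3m) and
   x |-> (f(x)_0, stair of shift(x)) identify the same points, which yields a
   bijection Psi x S -> S x Psi, that is a transducer with state set Psi whose
   runs compute f. When lambda_f = 1 / k, the states Psi x {1..k} can be encoded
   by the words of S^(3m), the second component being carried along unchanged. *)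
From mathcomp Require Import all_boot all_order all_algebra.
From mathcomp Require Import all_classical all_reals all_analysis.
From mathcomp Require Import zify.
Require Import Defs.

Set Implicit Arguments.
Unset Strict Implicit.
Unset Printing Implicit Defensive.

Import Order.TTheory GRing.Theory Num.Theory.
Import numFieldNormedType.Exports.

Local Open Scope classical_set_scope.
Local Open Scope ring_scope.

(** * Configurations *)

(** The topology is the supremum of those induced by the coordinates, each of which takes values in
    a discrete space. *)
Lemma cvg_configP (S : finType) (F : set_system (config S)) (x : config S) :
  Filter F -> (F --> x) <-> (forall k, \forall y \near F, y k = x k).
Proof.
move=> FF.
rewrite cvg_sup; split=> h k.
  have /(_ [set y : config S | y k = x k]) := h k; rewrite !nbhs_simpl.
  apply; exists [set y : config S | y k = x k]; split => //.
  exists [set a | a = x k]; last by [].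
  by rewrite openE => a /= ->; rewrite /interior nbhs_principalE;
    apply/principal_filterP.
move=> A [_ [[W oW <-] Wx WA]].
by apply: filterS (h k) => y yk; apply: WA; rewrite /= yk.
Qed.

Lemma near_window (T : Type) (F : set_system T) {FF : Filter F}
    (P : T -> int -> Prop) :
  (forall k, F [set n | P n k]) -> forall (j : int) (N : nat),
  F [set n | forall k : int, `|k - j| <= N%:Z -> P n k].
Proof.
move=> h j N.
have := @filter_forall T 'I_(N + N).+1
  (fun i n => P n (j + (nat_of_ord i)%:Z - N%:Z)) F FF (fun i => h _).
apply: filterS => n hn k hk.
have hk1 : (absz (k - j + N%:Z)%R < (N + N).+1)%N by lia.
have := hn (Ordinal hk1); rewrite /=.
by have -> : j + (absz (k - j + N%:Z))%:Z - N%:Z = k :> int by lia.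
Qed.

Lemma nbhs_configP (S : finType) (x : config S) (A : set (config S)) :
  nbhs x A <-> exists n : nat, forall y : config S,
    (forall k : int, `|k| <= n%:Z -> y k = x k) -> A y.
Proof.
split.
  pose F : set_system (config S) := filter_from setT (fun n : nat =>
    [set y : config S | forall k : int, `|k| <= n%:Z -> y k = x k]).
  have FF : Filter F.
    apply: filter_from_filter; first by exists 0%N.
    move=> i j _ _; exists (maxn i j) => // y /= h.
    by split=> k hk; apply: h; lia.
  have : F --> x.
    apply/cvg_configP => k; exists `|k|%N => // y /=; apply; lia.
  by move=> /(_ A); rewrite !nbhs_simpl => + xA => /(_ xA) [n _ h]; exists n.
move=> [n h]; apply: filterS h _.
have hx k : nbhs x [set y | y k = x k].
  by have /cvg_configP -/(_ k) := @cvg_refl _ (nbhs x).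
have FF : Filter (nbhs x) by exact: nbhs_filter.
apply: filterS (near_window hx 0 n) => y hy k hk; apply: hy; lia.
Qed.

(** * Compactness through ultrafilters *)

Lemma ultra_ex2 (T : Type) (U : set_system T) (FU : UltraFilter U)
    (A B : set T) :
  U A -> U B -> exists2 n, A n & B n.
Proof.
by move=> UA UB; have [n [An Bn]] := filter_ex (filterI UA UB); exists n.
Qed.

Lemma ultra_ex3 (T : Type) (U : set_system T) (FU : UltraFilter U)
    (A B C : set T) :
  U A -> U B -> U C -> exists n, [/\ A n, B n & C n].
Proof.
move=> UA UB UC.
by have [n [An Bn] Cn] := ultra_ex2 FU (filterI UA UB) UC; exists n.
Qed.

Lemma exists_ultrafilter_nat : exists U : set_system nat, UltraFilter U /\
  forall m, U [set n | (m <= n)%N].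
Proof.
have [U [FU sU]] := ultraFilterLemma (F := eventually) _.
by exists U; split => // m; apply: sU; exists m.
Qed.

Lemma ultra_fin (T : Type) (U : set_system T) (S : finType) (c : T -> S) :
  UltraFilter U -> exists s, U [set n | c n = s].
Proof.
move=> FU; apply: contrapT => /forallNP h.
have : \forall n \near U, forall s, c n <> s.
  apply: filter_forall => s.
  by have [/h//|] := in_ultra_setVsetC [set n | c n = s] FU.
by move=> /filter_ex [n /(_ (c n))].
Qed.

(** Compactness without subsequences: along an ultrafilter a function with finitely many values is
    constant, so limits can be taken coordinate by coordinate. *)
Lemma ultra_limit (T I : Type) (U : set_system T) (S : finType)
    (x : T -> I -> S) :
  UltraFilter U -> exists y : I -> S, forall i, U [set n | x n i = y i].
Proof.
move=> FU; have /choice [y hy] : forall i, exists s, U [set n | x n i = s].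
  by move=> i; apply: ultra_fin.
by exists y.
Qed.

(** * Local maps and uniform left-closing *)

Definition local_map (S : finType) (r : nat) (f : config S -> config S) :=
  forall (x x' : config S) (j : int),
    (forall t : int, j - r%:Z <= t <= j + r%:Z -> x t = x' t) -> f x j = f x' j.

Definition translate (S : finType) (j : int) (x : config S) : config S :=
  fun t => x (t + j).

Lemma translate_commute (S : finType) (f : config S -> config S) :
  (forall x, f (shift x) = shift (f x)) ->
  forall j x, f (translate j x) = translate j (f x).
Proof.
move=> h.
have hn (n : nat) x : f (translate n%:Z x) = translate n%:Z (f x).
  elim: n x => [|n IH] x.
    have tr0 (y : config S) : translate 0 y = y.
      by apply/funext => t; rewrite /translate addr0.
    by rewrite !tr0.
  have trS (y : config S) : translate n.+1%:Z y = shift (translate n%:Z y).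
    by apply/funext => t; rewrite /translate /shift; congr y; lia.
  by rewrite !trS h IH.
case=> n x; first exact: hn.
have trK (y : config S) : translate n.+1%:Z (translate (Negz n) y) = y.
  by apply/funext => t; rewrite /translate; congr y; lia.
have trK' (y : config S) : translate (Negz n) (translate n.+1%:Z y) = y.
  by apply/funext => t; rewrite /translate; congr y; lia.
by rewrite -[in RHS](trK x) hn trK'.
Qed.

Lemma local_mapW (S : finType) (r r' : nat) (f : config S -> config S) :
  (r <= r')%N -> local_map r f -> local_map r' f.
Proof. by move=> rr h x x' j H; apply: h => t ht; apply: H; lia. Qed.

Lemma local_continuous (S : finType) (r : nat) (f : config S -> config S) :
  local_map r f -> continuous f.
Proof.
move=> h x; have FF : Filter (nbhs x) by exact: nbhs_filter.
have [_] := @cvg_configP S (f @ x) (f x) _; apply=> k.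
have [_] := @nbhs_configP S x [set y | f y k = f x k]; apply.
exists (r + `|k|)%N => y hy; apply: h => t ht; apply: hy; lia.
Qed.

Lemma not_local_pairs (S : finType) (f : config S -> config S) :
  (forall j x, f (translate j x) = translate j (f x)) ->
  ~ (exists r, local_map r f) ->
  exists xx : nat -> config S * config S, forall n,
    (forall t : int, `|t| <= n%:Z -> (xx n).1 t = (xx n).2 t) /\
    f (xx n).1 0 <> f (xx n).2 0.
Proof.
move=> f_translate /forallNP H.
have {}H (n : nat) : exists xx : config S * config S,
    (forall t : int, `|t| <= n%:Z -> xx.1 t = xx.2 t) /\ f xx.1 0 <> f xx.2 0.
  apply: contrapT => /forallNP Hn; apply: (H n) => x x' j hx.
  apply: contrapT => fx; apply: (Hn (translate j x, translate j x')).
  by split => /= [t ht|]; [apply: hx; lia|rewrite !f_translate // /translate add0r].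
by have [xx] := choice H; exists xx.
Qed.

(** Curtis-Hedlund-Lyndon: pairs witnessing non-locality on ever larger windows have a common
    ultralimit [x], and continuity at [x] makes both images equal to [f x] at 0. *)
Lemma cellular_automaton_local (S : finType) (f : config S -> config S) :
  cellular_automaton f -> exists r, local_map r f.
Proof.
move=> [cf sf]; apply: contrapT => /(not_local_pairs (translate_commute sf)) [xx H].
have [U [FU Uinf]] := exists_ultrafilter_nat.
have [x hx] : exists x : config S, forall i, U [set n | (xx n).1 i = x i].
  exact: ultra_limit (fun n t => ((xx n).1 t : S)) FU.
have FF : Filter (nbhs x) by exact: nbhs_filter.
have [/(_ (cf x) 0) fx0 _] := @cvg_configP S (f @ x) (f x) _.
have [/(_ fx0) [N hN] _] := @nbhs_configP S x [set y | f y 0 = f x 0].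
have [n /= Nn hn] := ultra_ex2 FU (Uinf N) (near_window hx 0 N).
have h1 k : `|k| <= N%:Z -> (xx n).1 k = x k by move=> hk; apply: hn; lia.
have [h2] := H n; apply.
by rewrite !hN // => k hk; rewrite -h2 ?h1 //; lia.
Qed.

(** The uniform form of [left_closing], obtained from it by compactness. *)
Definition closing_range (S : finType) (L : nat) (f : config S -> config S) :=
  forall (x x' : config S) (j : int),
    (forall t : int, j < t <= j + L%:Z -> x t = x' t) ->
    (forall t : int, j - L%:Z <= t <= j + L%:Z -> f x t = f x' t) -> x j = x' j.

Lemma closing_rangeW (S : finType) (r r' : nat) (f : config S -> config S) :
  (r <= r')%N -> closing_range r f -> closing_range r' f.
Proof.
by move=> rr h x x' j H H'; apply: h => t ht; [apply: H | apply: H']; lia.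
Qed.

(** If every range failed, the counterexamples moved to the origin would have ultralimits that
    differ at 0, agree from 1 on and have equal images. *)
Lemma left_closing_range (S : finType) (f : config S -> config S) :
  cellular_automaton f -> left_closing f -> exists L, closing_range L f.
Proof.
move=> caf lc; have [r lf] := cellular_automaton_local caf.
case: caf => _ sf; apply: contrapT => /forallNP H.
have {}H (n : nat) : exists xx : config S * config S,
   [/\ forall t : int, 0 < t <= n%:Z -> xx.1 t = xx.2 t,
    forall t : int, `|t| <= n%:Z -> f xx.1 t = f xx.2 t & xx.1 0 <> xx.2 0].
  apply: contrapT => /forallNP Hn; apply: (H n) => x x' j hx hf.
  apply: contrapT => fx; apply: (Hn (translate j x, translate j x')).
  split => /= [t ht|t ht|].
  - by apply: hx; lia.
  - by rewrite !translate_commute // /translate; apply: hf; lia.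
  - by rewrite /translate add0r.
have [xx {}H] := choice H.
have [U [FU Uinf]] := exists_ultrafilter_nat.
have [x hx] : exists x : config S, forall i, U [set n | (xx n).1 i = x i].
  exact: ultra_limit (fun n t => ((xx n).1 t : S)) FU.
have [x' hx'] : exists x : config S, forall i, U [set n | (xx n).2 i = x i].
  exact: ultra_limit (fun n t => ((xx n).2 t : S)) FU.
have fU (z : config S) (zz : nat -> config S) j :
    (forall i, U [set n | zz n i = z i]) -> U [set n | f (zz n) j = f z j].
  move=> hz.
  apply: filterS (near_window hz j r) => n hn /=; apply: lf => t ht.
  by apply: hn; lia.
apply: (lc x x').
- move=> xx'; have [n /= e e'] := ultra_ex2 FU (hx 0) (hx' 0).
  by have [_ _] := H n; rewrite e e' xx'.
- exists 1 => k k1.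
  have [n [/= kn e e']] := ultra_ex3 FU (Uinf `|k|%N) (hx k) (hx' k).
  have [h _ _] := H n; rewrite -e -e'; apply: h; lia.
- apply/funext => k.
  have [n [/= kn e e']] :=
    ultra_ex3 FU (Uinf `|k|%N) (fU _ _ k hx) (fU _ _ k hx').
  have [_ h _] := H n; rewrite -e -e'; apply: h; lia.
Qed.

(** * Bijective transducers *)

Section Words.
Context (S Q : finType) (delta : Q * S -> S * Q) (gamma : S * Q -> Q * S).
Hypothesis deltaK : cancel delta gamma.
Hypothesis gammaK : cancel gamma delta.

Fixpoint final (q : Q) (p : seq S) : Q :=
  if p is a :: p' then final (delta (q, a)).2 p' else q.

Fixpoint output (q : Q) (p : seq S) : seq S :=
  if p is a :: p' then (delta (q, a)).1 :: output (delta (q, a)).2 p' else [::].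

Lemma size_output q p : size (output q p) = size p.
Proof. by elim: p q => //= a p IH q; rewrite IH. Qed.

Lemma final_cat q p p' : final q (p ++ p') = final (final q p) p'.
Proof. by elim: p q => //=. Qed.

Lemma output_cat q p p' :
  output q (p ++ p') = output q p ++ output (final q p) p'.
Proof. by elim: p q => //= a p IH q; rewrite IH. Qed.

(** Runs can be traced back: as [delta] is injective, the letter written and the next state give
    back the letter read and the state before. *)
Lemma output_final_inj q p q' p' :
  output q p = output q' p' -> final q p = final q' p' -> q = q' /\ p = p'.
Proof.
elim: p p' q q' => [|a p IH] [|a' p'] q q' //= [e1 e2] e3.
have [e4 ->] := IH _ _ _ e2 e3.
have : delta (q, a) = delta (q', a').
  by rewrite [LHS]surjective_pairing [RHS]surjective_pairing e1 e4.
by move=> /(can_inj deltaK) [-> ->].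
Qed.

Lemma backward_reading w s : exists q p, output q p = w /\ final q p = s.
Proof.
elim: w => [|b w [q [p [pw qs]]]]; first by exists s, [::].
exists (gamma (b, q)).1, ((gamma (b, q)).2 :: p) => /=.
by rewrite -surjective_pairing gammaK /= pw.
Qed.

Lemma output_split q p w1 w2 : output q p = w1 ++ w2 ->
  output q (take (size w1) p) = w1 /\
  output (final q (take (size w1) p)) (drop (size w1) p) = w2.
Proof.
move=> e; have := e; rewrite -{1}(cat_take_drop (size w1) p) output_cat.
move=> /eqP; rewrite eqseq_cat; first by move=> /andP [/eqP -> /eqP ->].
rewrite size_output size_takel //.
by rewrite -(size_output q p) e size_cat leq_addr.
Qed.

(* delta maps R x S injectively into S x R for the set R of states reachable
   from a, hence bijectively; so R is also closed under predecessors. *)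
Lemma reachable_sym a s p : final s p = a -> exists p', final a p' = s.
Proof.
pose R := [set t | `[< exists p', final a p' = t >]]%SET.
have RP t : reflect (exists p', final a p' = t) (t \in R).
  by rewrite inE; apply: asboolP.
have Rfwd t c : t \in R -> (delta (t, c)).2 \in R.
  move=> /RP [p' <-]; apply/RP; exists (p' ++ [:: c]).
  by rewrite final_cat.
have Reqv : (delta @: finset.setX R [set: S] = finset.setX [set: S] R)%SET.
  apply/eqP; rewrite eqEcard; apply/andP; split.
    apply/fintype.subsetP => _ /imsetP [[t c] /setXP [tR _] ->].
    by rewrite finset.inE /= finset.in_setT Rfwd.
  by rewrite card_imset ?cardsX; [rewrite mulnC|exact: can_inj deltaK].
have Rbwd t c : (delta (t, c)).2 \in R -> t \in R.
  move=> h; have : delta (t, c) \in finset.setX [set: S]%SET R.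
    by rewrite finset.inE finset.in_setT.
  rewrite -Reqv => /imsetP [[t' c'] /setXP [t'R _]].
  by move=> /(can_inj deltaK) [-> _].
move=> sa; apply/RP.
have : final s p \in R by rewrite sa; apply/RP; exists [::].
by elim: p s {sa} => //= c p IH s /IH /Rbwd.
Qed.

(* States with the same output on every future input, but which the output
   word w of the past forces to have been reached by different inputs. *)
Definition confusable (A : {set Q}) (w : seq S) :=
  {in A &, forall a b p, output a p = output b p} /\
  {in A &, forall a b q q' p, output q p = w -> output q' p = w ->
     final q p = a -> final q' p = b -> a = b}.

(* Looping from a back to a along an output word ending in w sends b to a
   fresh confusable state. *)
Lemma confusable_extend A w a b : confusable A w -> a \in A -> b \in A ->
  a <> b -> exists c w', c \notin A /\ confusable (c |: A)%SET w'.
Proof.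
move=> [out_eq in_neq] aA bA ab.
(* Tracing back from [a] along [w] leads to [s], and [p0] leads from [a] to [s]; so [P] is a loop at
   [a] that writes [w0 ++ w]. *)
have [s [p [sp pa]]] := backward_reading w a.
have [p0 ap0] := reachable_sym pa.
set w0 := output a p0; pose P := p0 ++ p.
have aP : final a P = a by rewrite final_cat ap0.
have oP : output a P = w0 ++ w by rewrite output_cat ap0 sp.
have oPb : output b P = w0 ++ w by rewrite -oP; apply: out_eq.
pose c := final b P; pose s' := final b p0.
have s'p : output s' p = w.
  move: oPb; rewrite output_cat => /eqP; rewrite eqseq_cat.
    by move=> /andP [_ /eqP].
  by rewrite !size_output.
have s'c : final s' p = c by rewrite /c final_cat.
have ac : a <> c.
  move=> ac; apply: ab.
  by have [] := @output_final_inj a P b P; rewrite ?oP ?oPb ?aP.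
(* If [c] were in [A], it and [a] would be reached by the same input [p] with output [w]. *)
have cA : c \notin A by apply/negP => cA; apply: ac; apply: (in_neq a c _ _ s s' p).
(* On [P ++ r] the states [a] and [b] write the same word; what is written after [P] is the output
   of [a], respectively [c], on [r]. *)
have out_c r : output c r = output a r.
  have := out_eq _ _ bA aA (P ++ r).
  rewrite (output_cat b P) (output_cat a P) aP oP oPb => /eqP; rewrite eqseq_cat //.
  by move=> /andP [_ /eqP].
(* Suppose one input [r] leads both to [a1] in [A] and to [c]. Traced back from [c], it ends in [P],
   read from [b]. Then [in_neq] on the suffix [p] gives [a1 = a], tracing back [P] from [a] leads to
   [a], and [in_neq] on the prefix [r1] gives [a = b]. *)
have key a1 q q' r : a1 \in A -> output q r = w ++ w0 ++ w ->
    output q' r = w ++ w0 ++ w -> final q r = a1 -> final q' r = c -> False.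
  move=> a1A oq oq' fq fq'.
  have [oq1 oq2] := output_split oq; have [oq1' oq2'] := output_split oq'.
  set r1 := take _ r in oq1 oq2 oq1' oq2'.
  set r2 := drop _ r in oq2 oq2'.
  have er : r = r1 ++ r2 by rewrite cat_take_drop.
  move: fq fq'; rewrite er !final_cat => fq fq'.
  have [q'b r2P] : final q' r1 = b /\ r2 = P.
    by apply: output_final_inj; rewrite ?oq2' ?oPb ?fq'.
  have a1a : a1 = a.
    apply: (in_neq a1 a a1A aA (final (final q r1) p0) s p) => //.
      move: oq2; rewrite r2P output_cat => /eqP; rewrite eqseq_cat.
        by move=> /andP [_ /eqP].
      by rewrite !size_output.
    by rewrite -fq r2P final_cat.
  have [qa _] : final q r1 = a /\ r2 = P.
    by apply: output_final_inj; rewrite ?oq2 ?oP ?fq ?aP.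
  by apply: ab; apply: (in_neq a b aA bA q q' r1).
exists c, (w ++ w0 ++ w); split => //; split.
  have h x : x \in (c |: A)%SET -> forall r, output x r = output a r.
    by move=> /setU1P [->|xA] r //; apply: out_eq.
  by move=> x y /h hx /h hy r; rewrite hx hy.
move=> x y /setU1P [->|xA] /setU1P [->|yA] q q' r oq oq' fq fq' //.
- by case: (key y q' q r).
- by case: (key x q q' r).
have [oq1 oq2] := output_split oq; have [oq1' oq2'] := output_split oq'.
have [oq3 oq4] := output_split oq2; have [oq3' oq4'] := output_split oq2'.
apply: (in_neq x y xA yA _ _ _ oq4 oq4').
  by rewrite -2!final_cat !cat_take_drop.
by rewrite -2!final_cat !cat_take_drop.
Qed.

(** Two confusable states could be extended repeatedly to a set with more elements than [Q]. *)
Lemma confusable_card A w : confusable A w -> (#|A| <= 1)%N.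
Proof.
move=> Aw; rewrite leqNgt; apply/negP => A2.
have [B [v [_ Bgt]]] : exists B v, confusable B v /\ (#|Q|.+2 <= #|B|)%N.
  elim: #|Q| => [|n [B [v [Bv Bn]]]]; first by exists A, w.
  have /card_gt1P [a [b [aB bB /eqP ab]]] : (1 < #|B|)%N by lia.
  have [c [v' [cB cv']]] := confusable_extend Bv aB bB ab.
  by exists (c |: B)%SET, v'; split => //; rewrite cardsU1 cB; lia.
by have := leq_trans Bgt (max_card (mem B)); rewrite ltnNge leqnSn.
Qed.

End Words.

(** * Bi-infinite runs *)

Section Runs.
Context (S Q : finType) (delta : Q * S -> S * Q) (gamma : S * Q -> Q * S).
Context (d : nat).
Hypothesis deltaK : cancel delta gamma.
Hypothesis gammaK : cancel gamma delta.

(* A bi-infinite run: in state q_j the letter y_(j + d) is read and z_j is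
   written; the block rule holds d cells in its state. *)
Definition run (q : int -> Q) (y z : config S) : Prop :=
  forall j : int, delta (q j, y (j + d%:Z)) = (z j, q (j + 1)).

Lemma run_translate q y z (j : int) :
  run q y z -> run (fun t => q (t + j)) (translate j y) (translate j z).
Proof.
move=> h t; have := h (t + j); rewrite /translate.
have -> : t + j + d%:Z = t + d%:Z + j by lia.
by have -> : t + j + 1 = t + 1 + j by lia.
Qed.

Lemma run_forward q y z q' y' z' (i : int) (n : nat) :
  run q y z -> run q' y' z' -> q i = q' i ->
  (forall t : int, i + d%:Z <= t < i + n%:Z + d%:Z -> y t = y' t) ->
  q (i + n%:Z) = q' (i + n%:Z) /\
  (forall t : int, i <= t < i + n%:Z -> z t = z' t).
Proof.
move=> h h' e; elim: n => [|n IH] ey.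
  by split=> [|t]; [rewrite addr0|lia].
have [e1 e2] : q (i + n%:Z) = q' (i + n%:Z) /\
    (forall t : int, i <= t < i + n%:Z -> z t = z' t).
  by apply: IH => t ht; apply: ey; lia.
have := h (i + n%:Z); rewrite e1 ey; last by lia.
rewrite h' => -[e3 e4]; split.
  have -> : i + n.+1%:Z = i + n%:Z + 1 by lia.
  by rewrite e4.
move=> t ht; have [->//|tn] := eqVneq t (i + n%:Z).
by apply: e2; lia.
Qed.

Lemma run_backward q y z q' y' z' (i : int) (n : nat) :
  run q y z -> run q' y' z' -> q i = q' i ->
  (forall t : int, i - n%:Z <= t < i -> z t = z' t) ->
  q (i - n%:Z) = q' (i - n%:Z) /\
  (forall t : int, i - n%:Z + d%:Z <= t < i + d%:Z -> y t = y' t).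
Proof.
move=> h h' e; elim: n => [|n IH] ez.
  by split=> [|t]; [rewrite subr0|lia].
have [e1 e2] : q (i - n%:Z) = q' (i - n%:Z) /\
    (forall t : int, i - n%:Z + d%:Z <= t < i + d%:Z -> y t = y' t).
  by apply: IH => t ht; apply: ez; lia.
have h1 := h (i - n.+1%:Z); have h1' := h' (i - n.+1%:Z).
have e0 : i - n.+1%:Z + 1 = i - n%:Z by lia.
have : delta (q (i - n.+1%:Z), y (i - n.+1%:Z + d%:Z)) =
       delta (q' (i - n.+1%:Z), y' (i - n.+1%:Z + d%:Z)).
  by rewrite h1 h1' e0 e1 ez //; lia.
move=> /(can_inj deltaK) [e3 e4]; split => // t ht.
have [->//|tn] := eqVneq t (i - n.+1%:Z + d%:Z).
by apply: e2; lia.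
Qed.

(** States after [j] come from [delta] and the future input, states before [j] from [gamma] and the
    past output. *)
Lemma run_splice (j : int) (u : Q) (z y : config S) : exists q y' z',
  [/\ run q y' z', q j = u, forall t : int, t < j -> z' t = z t &
      forall t : int, j + d%:Z <= t -> y' t = y t].
Proof.
pose fw := fix fw n := if n is n'.+1
  then (delta (fw n', y (j + n'%:Z + d%:Z))).2 else u.
pose bw := fix bw n := if n is n'.+1
  then (gamma (z (j - n'.+1%:Z), bw n')).1 else u.
exists (fun t => if j <= t then fw (absz (t - j)%R) else bw (absz (t - j)%R)).
(* Cell [t] is read at step [t - d]; before [j] its letter is recovered from the output of that step
   and the state after it. *)
exists (fun t => if j + d%:Z <= t then y t else
  (gamma (z (t - d%:Z), bw (absz (j - (t - d%:Z) - 1)%R))).2).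
exists (fun t => if t < j then z t else
  (delta (fw (absz (t - j)%R), y (t + d%:Z))).1).
split; [|by rewrite lexx subrr|by move=> t ->|by move=> t ->].
move=> t; cbv beta.
have [jt|tj] := lerP j t.
  have -> : j <= t + 1 by lia.
  have -> : j + d%:Z <= t + d%:Z by lia.
  have -> : absz (t + 1 - j)%R = (absz (t - j)%R).+1 by lia.
  rewrite /=.
  have -> : j + (absz (t - j)%R)%:Z + d%:Z = t + d%:Z by lia.
  by rewrite -surjective_pairing.
have -> : (j + d%:Z <= t + d%:Z) = false by lia.
have -> : absz (t - j)%R = (absz (j - t - 1)%R).+1 by lia.
have -> : t + d%:Z - d%:Z = t by lia.
rewrite /=.
have -> : j - (absz (j - t - 1)%R).+1%:Z = t by lia.
rewrite -surjective_pairing gammaK; congr pair.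
have [jt1|jt1] := lerP j (t + 1).
  have -> : absz (j - t - 1)%R = 0%N by lia.
  by have -> : absz (t + 1 - j)%R = 0%N by lia.
by have -> : absz (j - t - 1)%R = absz (t + 1 - j)%R by lia.
Qed.

Fixpoint word (x : config S) (i : int) (n : nat) : seq S :=
  if n is n'.+1 then (x i : S) :: word x (i + 1) n' else [::].

Lemma word_eq (x x' : config S) i n :
  word x i n = word x' i n <->
  (forall t : int, i <= t < i + n%:Z -> x t = x' t).
Proof.
elim: n i => [|n IH] i /=; first by split => // _ t; lia.
split=> [[e /IH h] t ht|h].
  by have [->//|ti] := eqVneq t i; apply: h; lia.
congr cons; first by apply: h; lia.
by apply/IH => t ht; apply: h; lia.
Qed.

Lemma run_word q y z i n : run q y z ->
  output delta (q i) (word y (i + d%:Z) n) = word z i n /\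
  final delta (q i) (word y (i + d%:Z) n) = q (i + n%:Z).
Proof.
move=> h; elim: n i => [|n IH] i /=; first by rewrite addr0.
rewrite h /=.
have -> : i + d%:Z + 1 = i + 1 + d%:Z by lia.
have [-> ->] := IH (i + 1).
by have -> : i + 1 + n%:Z = i + n.+1%:Z by lia.
Qed.

End Runs.

(** * Counting the values of observations *)

Section Images.
Context (X : Type).

(** The type [X] may be infinite; cardinals are compared through the equalities between values of
    observations on [X]. *)
Definition img (T : finType) (O : X -> T) : {set T} :=
  [set t | `[< exists x, O x = t >]]%SET.

Lemma imgP (T : finType) (O : X -> T) t :
  reflect (exists x, O x = t) (t \in img O).
Proof. by rewrite finset.inE; apply: asboolP. Qed.

Lemma card_img_le (T1 T2 : finType) (O1 : X -> T1) (O2 : X -> T2) :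
  (forall x x', O1 x = O1 x' -> O2 x = O2 x') -> (#|img O2| <= #|img O1|)%N.
Proof.
move=> h; have [->|[t /imgP [x0 _]]] := set_0Vmem (img O2).
  by rewrite cards0.
have /choice [g hg] : forall t, exists x, t \in img O2 -> O2 x = t.
  move=> u; case: (boolP (u \in img O2)) => [/imgP [x xu]|_]; last by exists x0.
  by exists x.
have inj : {in img O2 &, injective (O1 \o g)}.
  by move=> a b aI bI /= /h; rewrite !hg.
rewrite -(card_in_imset inj); apply: subset_leq_card.
by apply/fintype.subsetP => _ /imsetP [u uI ->]; apply/imgP; exists (g u).
Qed.

Lemma card_img_eq (T1 T2 : finType) (O1 : X -> T1) (O2 : X -> T2) :
  (forall x x', O1 x = O1 x' <-> O2 x = O2 x') -> #|img O2| = #|img O1|.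
Proof.
by move=> h; apply/eqP; rewrite eqn_leq !card_img_le // => x x' /h.
Qed.

(** The pairs are counted fibre by fibre over the values of [O]. *)
Lemma card_img_pair (T U : finType) (O : X -> T) (V : X -> U) (kappa : nat) :
  (forall x, #|[set v | `[< exists x', O x' = O x /\ V x' = v >]]%SET| = kappa)
  -> #|img (fun x => (O x, V x))| = (#|img O| * kappa)%N.
Proof.
move=> h; rewrite -sum1_card (partition_big fst (mem (img O))) /=; last first.
  by move=> [t v] /imgP [x [<- _]]; apply/imgP; exists x.
rewrite -sum_nat_const; apply: eq_bigr => t /imgP [x <-].
rewrite -[RHS](h x) -[RHS](card_imset _ (can_inj (fun v => erefl : (O x, v).2 = v))).
rewrite -sum1_card; apply: eq_bigl => -[t' v].
apply/andP/imsetP => [[/imgP [x' [<- <-]] /= /eqP e]|].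
  by exists (V x'); rewrite ?e // finset.inE; apply/asboolP; exists x'.
move=> [v']; rewrite finset.inE => /asboolP [x' [e1 e2]] [-> ->]; split => //.
by apply/imgP; exists x'; rewrite e1 e2.
Qed.

End Images.

Lemma windowP (S : finType) (n : nat) (x x' : config S) (i i' : int) :
  window n x i = window n x' i' <->
  (forall t : int, 0 <= t < n%:Z -> x (i + t) = x' (i' + t)).
Proof.
split=> [h t ht|h].
  have tn : (absz t < n)%N by lia.
  have := congr1 (fun w => tnth w (Ordinal tn)) h; rewrite !tnth_mktuple /=.
  by have -> : (absz t)%:Z = t by lia.
apply/eq_from_tnth => k; rewrite !tnth_mktuple; apply: h.
by have := ltn_ord k; lia.
Qed.

Lemma window_eq (S : finType) (n : nat) (x x' : config S) (i : int) :
  window n x i = window n x' i <->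
  (forall t : int, i <= t < i + n%:Z -> x t = x' t).
Proof.
rewrite windowP; split=> h t ht; last by apply: h; lia.
have e : i + (t - i) = t by lia.
by have := h (t - i); rewrite e; apply; lia.
Qed.

Lemma window_surj (S : finType) (n : nat) (x : config S) (i : int)
    (w : n.-tuple S) :
  exists x' : config S, window n x' i = w /\
    forall t : int, ~ (i <= t < i + n%:Z) -> x' t = x t.
Proof.
exists (fun t => if (i <= t) && (t < i + n%:Z) then nth (x t : S) w (absz (t - i)%R)
  else x t); split; last by move=> t /negP /negbTE ->.
apply/eq_from_tnth => k; rewrite tnth_mktuple (tnth_nth (x (i + k%:Z) : S)).
have -> : (i <= i + k%:Z) && (i + k%:Z < i + n%:Z) by have := ltn_ord k; lia.
by have -> : absz (i + k%:Z - i)%R = k by lia.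
Qed.

Lemma word_surj (S : finType) (x : config S) (i : int) (p : seq S) :
  exists x' : config S, word x' i (size p) = p.
Proof.
elim: p i => [|c p IH] i; first by exists x.
have [x' e] := IH (i + 1); exists (fun t => if t == i then c else x' t) => /=.
rewrite eqxx; congr cons; rewrite -[RHS]e; apply/word_eq => t ht.
by case: eqP => // ti; lia.
Qed.

(** * Run relations that are functions *)

Section RunFunction.
Context (S Q : finType) (delta : Q * S -> S * Q) (gamma : S * Q -> Q * S).
Context (d : nat) (f : config S -> config S).
Hypothesis deltaK : cancel delta gamma.
Hypothesis gammaK : cancel gamma delta.
Notation run := (run delta d).
Hypothesis run_fun : forall q y z, run q y z -> z = f y.
Hypothesis run_total : forall y, exists q, run q y (f y).

Lemma run_fun_translate (j : int) (y : config S) : f (translate j y) = translate j (f y).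
Proof.
by have [q /(run_translate j) /run_fun ->] := run_total y.
Qed.

(* An ultralimit of runs is a run. *)
Lemma run_fun_local : exists r, local_map r f.
Proof.
apply: contrapT => /(not_local_pairs run_fun_translate) [xx H].
have [U [FU Uinf]] := exists_ultrafilter_nat.
have lim (xs : nat -> config S) : exists y z q,
    [/\ forall i, U [set n | xs n i = y i], forall i, U [set n | f (xs n) i = z i]
      & run q y z].
  have /choice [qs hqs] : forall n, exists q, run q (xs n) (f (xs n)).
    by move=> n; apply: run_total.
  have [y hy] : exists y : config S, forall i, U [set n | xs n i = y i].
    exact: ultra_limit (fun n t => (xs n t : S)) FU.
  have [z hz] : exists z : config S, forall i, U [set n | f (xs n) i = z i].
    exact: ultra_limit (fun n t => (f (xs n) t : S)) FU.
  have [q hq] := ultra_limit qs FU.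
  exists y, z, q; split => // j.
  have [n [/= e1 [e2 e3] e4]] := ultra_ex3 FU (hq j)
    (filterI (hq (j + 1)) (hy (j + d%:Z))) (hz j).
  by have := hqs n j; rewrite e1 e2 e3 e4.
have [y [z [q [hy hz /run_fun zy]]]] := lim (fun n => (xx n).1).
have [y' [z' [q' [hy' hz' /run_fun zy']]]] := lim (fun n => (xx n).2).
have yy' : y = y'.
  apply/funext => k.
  have [n [/= kn e e']] := ultra_ex3 FU (Uinf (absz k)) (hy k) (hy' k).
  have [h _] := H n; rewrite -e -e'; apply: h; lia.
have [n /= e e'] := ultra_ex2 FU (hz 0) (hz' 0).
by have [_ []] := H n; rewrite e e' zy zy' yy'.
Qed.

Lemma run_fun_cellular_automaton : cellular_automaton f.
Proof.
split; last by move=> x; apply: (run_fun_translate 1 x).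
by have [r /local_continuous] := run_fun_local.
Qed.

(** For a counterexample [y], [y'], the states of the two runs at [j = i + r] are distinct, since
    tracing back the common output from equal states would give equal inputs. Yet they are
    confusable, which [confusable_card] excludes. *)
Lemma run_fun_left_closing : left_closing f.
Proof.
move=> y y' yy' [i yi] fy.
have [r lf] := run_fun_local.
have [k yk] : exists k, y k <> y' k.
  by apply/existsNP => h; apply: yy'; apply/funext.
have [q hq] := run_total y; have [q' hq'] := run_total y'.
pose j : int := i + r%:Z.
have ki : k < i by rewrite ltNge; apply/negP => /yi.
(* The [n] steps before [j] read the cells from [k] to [j + d - 1], hence the difference at [k]. *)
pose n := absz (j + d%:Z - k)%R.
set w := word (f y) (j - n%:Z) n.
have [oq fq] := run_word (j - n%:Z) n hq.
have [oq' fq'] := run_word (j - n%:Z) n hq'.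
rewrite -fy -/w in oq'; rewrite -/w in oq; rewrite !subrK in fq fq'.
have wneq : word y (j - n%:Z + d%:Z) n <> word y' (j - n%:Z + d%:Z) n.
  by move=> /word_eq /(_ k) e; apply: yk; apply: e; rewrite /n /j; lia.
have qq' : q j <> q' j.
  move=> e; apply: wneq; rewrite -fq -fq' in e.
  by have [] := output_final_inj deltaK (etrans oq (esym oq')) e.
suff : confusable delta [set q j; q' j]%SET w.
  by move=> /(confusable_card deltaK gammaK); rewrite cards2; case: eqP.
split.
  (* Continue both runs from [j] with the same future input. Their past inputs remain those of [y]
     and [y'], so the new inputs agree from [i] on, and by locality their images agree from
     [i + r = j] on. *)
  suff h p : output delta (q j) p = output delta (q' j) p.
    move=> a b; rewrite !finset.inE => /orP [] /eqP -> /orP [] /eqP -> p //.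
  have [y0 y0p] := word_surj y (j + d%:Z) p.
  have [q1 [y1 [z1 [run1 qj1 zz1 yy1]]]] :=
    run_splice d gammaK j (q j) (f y) y0.
  have [q2 [y2 [z2 [run2 qj2 zz2 yy2]]]] :=
    run_splice d gammaK j (q' j) (f y) y0.
  have y1y (t : int) : t < j + d%:Z -> y1 t = y t.
    move=> tj; pose N := absz (j + d%:Z - t)%R.
    have [_ h] := @run_backward _ _ _ _ _ deltaK _ _ _ _ _ _ j N run1 hq qj1
      (fun t ht => zz1 t (proj2 (andP ht))).
    by apply: h; rewrite /N; lia.
  have y2y (t : int) : t < j + d%:Z -> y2 t = y' t.
    move=> tj; pose N := absz (j + d%:Z - t)%R.
    rewrite fy in zz2.
    have [_ h] := @run_backward _ _ _ _ _ deltaK _ _ _ _ _ _ j N run2 hq' qj2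
      (fun t ht => zz2 t (proj2 (andP ht))).
    by apply: h; rewrite /N; lia.
  have y12 (t : int) : i <= t -> y1 t = y2 t.
    move=> it; have [tj|tj] := ltP t (j + d%:Z).
      by rewrite y1y // y2y // yi.
    by rewrite yy1 // yy2.
  have z12 (t : int) : j <= t -> z1 t = z2 t.
    move=> jt; rewrite (run_fun run1) (run_fun run2); apply: lf => u hu.
    by apply: y12; rewrite /j in jt; lia.
  have yp (x : config S) : (forall t : int, j + d%:Z <= t -> x t = y0 t) ->
      word x (j + d%:Z) (size p) = p.
    by move=> hx; rewrite -[RHS]y0p; apply/word_eq => t ht; apply: hx; lia.
  have [out1 _] := run_word j (size p) run1.
  have [out2 _] := run_word j (size p) run2.
  rewrite -qj1 -qj2 -{1}(yp _ yy1) -{2}(yp _ yy2) out1 out2.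
  by apply/word_eq => t ht; apply: z12; lia.
(* Tracing back along [w] from [q j] gives only the word of [y], and from [q' j] only that of [y'];
   these words differ. *)
have h s p : output delta s p = w -> final delta s p = q j ->
    p = word y (j - n%:Z + d%:Z) n.
  move=> out1 f1.
  by have [] := output_final_inj deltaK
    (etrans out1 (esym oq)) (etrans f1 (esym fq)).
have h' s p : output delta s p = w -> final delta s p = q' j ->
    p = word y' (j - n%:Z + d%:Z) n.
  move=> out1 f1.
  by have [] := output_final_inj deltaK
    (etrans out1 (esym oq')) (etrans f1 (esym fq')).
move=> a b; rewrite !finset.inE => /orP [] /eqP -> /orP [] /eqP ->
  s s' p // out1 out2 f1 f2.
  by case: wneq; rewrite -(h _ _ out1 f1) -(h' _ _ out2 f2).
by case: wneq; rewrite -(h _ _ out2 f2) -(h' _ _ out1 f1).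
Qed.

End RunFunction.

(** * The number of states over an input, and the number of stairs *)

Section StateCount.
Context (S Q : finType) (delta : Q * S -> S * Q) (gamma : S * Q -> Q * S).
Context (d : nat) (f : config S -> config S).
Hypothesis deltaK : cancel delta gamma.
Hypothesis gammaK : cancel gamma delta.
Notation run := (run delta d).
Hypothesis run_fun : forall q y z, run q y z -> z = f y.
Hypothesis run_total : forall y, exists q, run q y (f y).

Definition states_at (y : config S) (j : int) : {set Q} :=
  img (fun q : {q : int -> Q | run q y (f y)} => sval q j).

Lemma states_atP y j u :
  reflect (exists q, run q y (f y) /\ q j = u) (u \in states_at y j).
Proof.
apply: (iffP (imgP _ _)) => [[[q hq] /= qu]|[q [hq qu]]]; first by exists q.
by exists (exist _ q hq).
Qed.

(** For fixed input and output a run is deterministic in both directions, so its states at two times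
    determine each other. *)
Lemma card_states_shift y (j : int) (n : nat) :
  #|states_at y (j + n%:Z)| = #|states_at y j|.
Proof.
apply: card_img_eq => -[q hq] [q' hq'] /=; split=> e.
  by have [] := run_forward (n := n) hq hq' e (fun _ _ => erefl).
have [] := run_backward (n := n) deltaK hq hq' e (fun _ _ => erefl).
by have -> : j + n%:Z - n%:Z = j by lia.
Qed.

Context (r : nat).
Hypothesis f_local : local_map r f.

(** Splice the past output [f y], the state [q' j] and the future input [y]. Tracing back [r + d]
    steps shows that the new input agrees with [y] from [j - r] on; so its image is [f y]
    everywhere, and left-closing makes it equal to [y]. *)
Lemma states_at_local q' y' z' y (j : int) : run q' y' z' ->
  (forall t : int, j - r%:Z <= t < j + d%:Z -> y' t = y t) ->
  (forall t : int, j - (r + d)%:Z <= t < j -> z' t = f y t) ->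
  q' j \in states_at y j.
Proof.
move=> hq' ey ez; have [q1 [y1 [z1 [run1 qj1 zz1 yy1]]]] :=
  run_splice d gammaK j (q' j) (f y) y.
have ez1 (t : int) : j - (r + d)%:Z <= t < j -> z1 t = z' t.
  by move=> ht; rewrite ez ?zz1 //; lia.
have [_ ey1] := run_backward deltaK run1 hq' qj1 ez1.
have {}ey1 (t : int) : j - r%:Z <= t -> y1 t = y t.
  move=> ht; have [tj|tj] := leP (j + d%:Z) t; first exact: yy1.
  by rewrite ey1 ?ey //; lia.
have z1y : z1 = f y.
  apply/funext => t; have [tj|tj] := ltP t j; first exact: zz1.
  by rewrite (run_fun run1); apply: f_local => k hk; apply: ey1; lia.
have y1y : y1 = y.
  apply: contrapT => h.
  apply: (run_fun_left_closing deltaK gammaK run_fun run_total h).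
    by exists (j - r%:Z) => k; apply: ey1.
  by rewrite -(run_fun run1).
by apply/states_atP; exists q1; rewrite qj1 -z1y -y1y.
Qed.

Lemma states_at_sub y y' (j : int) :
  (forall t : int, j - (r + r + d)%:Z <= t <= j + (r + d)%:Z -> y t = y' t) ->
  (states_at y j \subset states_at y' j)%SET.
Proof.
move=> e; apply/fintype.subsetP => _ /states_atP [q [hq <-]].
apply: (states_at_local hq) => t ht; first by apply: e; lia.
by apply: f_local => k hk; apply: e; lia.
Qed.

Lemma states_at_eq y y' (j : int) :
  (forall t : int, j - (r + r + d)%:Z <= t <= j + (r + d)%:Z -> y t = y' t) ->
  states_at y j = states_at y' j.
Proof.
move=> e; apply/eqP; rewrite finset.eqEsubset !states_at_sub // => t ht.
by rewrite e.
Qed.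

Lemma card_states_const y y' j j' : #|states_at y j| = #|states_at y' j'|.
Proof.
have card0 x i : #|states_at x i| = #|states_at x 0|.
  case: i => n; first by rewrite -[RHS](card_states_shift _ _ n) add0r.
  rewrite -[LHS](card_states_shift _ _ n.+1).
  by have -> : Negz n + n.+1%:Z = 0 by lia.
rewrite card0 (card0 y').
(* The glued [x] has the states of [y] far to the left and those of [y'] far to the right, and the
   count is constant along [x]. *)
pose x : config S := fun t => if t < 0 then y t else y' t.
pose N : int := (r + r + d).+1%:Z.
rewrite -(card0 y (- N)) -(card0 y' N).
have <- : states_at x (- N) = states_at y (- N).
  by apply: states_at_eq => t; rewrite /x /N => ht; case: ifP => //; lia.
have <- : states_at x N = states_at y' N.
  by apply: states_at_eq => t; rewrite /x /N => ht; case: ifP => //; lia.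
by rewrite card0 (card0 x N).
Qed.

(** Pairs of a stair and a state at time [j] are counted twice: each stair allows [kappa] states,
    and a pair amounts to a free choice of the output on [[0, j)], the state at [j] and the input on
    [[j + d, 3m)]. *)
Lemma card_right_stairs_run (x0 : config S) (m kappa : nat) :
  #|Q| = (#|S| ^ d)%N -> (forall y j, #|states_at y j| = kappa) ->
  (r + d <= m)%N -> (#|right_stairs f m| * kappa = #|S| ^ (3 * m))%N.
Proof.
move=> cardQ hk rdm.
pose X := {c : (int -> Q) * config S | run c.1 c.2 (f c.2)}.
(* For this [j] a stair covers the input on [[j - r, j + d)] and the output on [[j - (r + d), j)],
   as [states_at_local] requires. *)
pose l := (r + d)%N; pose j := (m + l)%N.
pose O (c : X) := let y := (sval c).2 in
  (window (2 * m) y m%:Z, window (2 * m) (f y) 0).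
pose V (c : X) := (sval c).1 j%:Z.
pose n2 := (2 * m - l - d)%N.
pose O2 (c : X) := let y := (sval c).2 in
  (window j (f y) 0, (sval c).1 j%:Z, window n2 y (j + d)%:Z).
have OE : right_stairs f m = img O.
  apply/finset.setP => -[v w]; rewrite finset.inE; apply/asboolP/imgP => /=.
    move=> [y [<- <-]]; have [q hq] := run_total y.
    by exists (exist _ (q, y) hq).
  by move=> [[[q y] /= hq] [<- <-]]; exists y.
rewrite OE -(@card_img_pair _ _ _ O V); last first.
  move=> [[q y] /= hq]; rewrite -[RHS](hk y j%:Z).
  apply: eq_card => u; rewrite finset.inE; apply/asboolP/states_atP => /=.
    move=> [[[q' y'] /= hq'] [e1 <-]].
    have /window_eq e2 := congr1 snd e1; have {e1}/window_eq e1 := congr1 fst e1.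
    rewrite /V /=.
    apply/states_atP; apply: (states_at_local hq') => t ht.
      by apply: e1; rewrite /j /l in ht; lia.
    by apply: e2; rewrite /j /l in ht; lia.
  by move=> [q' [hq' <-]]; exists (exist _ (q', y) hq').
rewrite (@card_img_eq _ _ _ O2); last first.
  move=> [[q y] /= hq] [[q' y'] /= hq']; rewrite /O /V /O2 /=; split.
    move=> e; have /window_eq e3 := congr1 snd e.
    have /window_eq e1 := congr1 (fst \o fst) e.
    have {e} e2 := congr1 (snd \o fst) e.
    have ez (t : int) : j%:Z - j%:Z <= t < j%:Z -> f y t = f y' t.
      by move=> ht; apply: e1; lia.
    (* The past output gives back the input before [j + d], and the future input gives the output up
       to [2m = j + (m - l)]. *)
    have [_ e4] := run_backward deltaK hq hq' e2 ez.
    have ey (t : int) : j%:Z + d%:Z <= t < j%:Z + (m - l)%N%:Z + d%:Z -> y t = y' t.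
      by move=> ht; apply: e3; rewrite /n2 /j /l in ht *; lia.
    have [_ e5] := run_forward hq hq' e2 ey.
    congr (_, _, _) => //; apply/window_eq => t ht.
      have [tj|tj] := ltP t (j + d)%:Z.
        by apply: e4; lia.
      by apply: e3; rewrite /n2 /j /l in tj *; lia.
    have [tj|tj] := ltP t j%:Z; first by apply: e1; lia.
    by apply: e5; rewrite /j /l in tj *; lia.
  move=> e; have e3 := congr1 snd e.
  have /window_eq e1 := congr1 (fst \o fst) e.
  have {e} /window_eq e2 := congr1 (snd \o fst) e; congr (_, _, _) => //;
    apply/window_eq => t ht.
    by apply: e2; rewrite /j /l in ht; lia.
  by apply: e1; rewrite /n2 /j /l in ht; lia.
have -> : img O2 = [set: j.-tuple S * Q * n2.-tuple S]%SET.
  apply/finset.setP => -[[w u] v]; rewrite finset.in_setT; apply/imgP.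
  have [z0 [z0w _]] := window_surj x0 0 w.
  have [y0 [y0v _]] := window_surj x0 (j + d)%:Z v.
  have [q [y' [z' [hq qu hz hy]]]] := run_splice d gammaK j%:Z u z0 y0.
  have hq' := hq; rewrite (run_fun hq) in hq'.
  exists (exist _ (q, y') hq'); rewrite /O2 /= qu -z0w -y0v -(run_fun hq).
  by congr (_, _, _); apply/window_eq => t ht; [apply: hz|apply: hy]; lia.
rewrite cardsT !card_prod !card_tuple cardQ -!expnD; congr expn.
by rewrite /n2 /j /l; lia.
Qed.

End StateCount.

(** * Stairs and their density *)

Definition stair (S : finType) (f : config S -> config S) (m : nat)
    (x : config S) : (2 * m).-tuple S * (2 * m).-tuple S :=
  (window (2 * m) x m%:Z, window (2 * m) (f x) 0).

Lemma stair_eq (S : finType) (f : config S -> config S) (m : nat) x x' :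
  stair f m x = stair f m x' <->
  (forall t : int, m%:Z <= t < (3 * m)%:Z -> x t = x' t) /\
  (forall t : int, 0 <= t < (2 * m)%:Z -> f x t = f x' t).
Proof.
split=> [e|[e1 e2]].
  have /window_eq e2 := congr1 snd e; have {e}/window_eq e1 := congr1 fst e.
  by split=> t ht; [apply: e1|apply: e2]; lia.
by congr pair; apply/window_eq => t ht; [apply: e1|apply: e2]; lia.
Qed.

Lemma right_stairsE (S : finType) (f : config S -> config S) (m : nat) :
  right_stairs f m = img (stair f m).
Proof.
apply/finset.setP => -[v w]; rewrite finset.inE; apply/asboolP/imgP => /=.
  by move=> [y [<- <-]]; exists y.
by move=> [y [<- <-]]; exists y.
Qed.

Section Density.
Context (S : finType) (f : config S -> config S) (r : nat).
Hypothesis f_local : local_map r f.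
Hypothesis f_closing : closing_range r f.

(** The larger stair is equivalent to the smaller one with three more input cells, which are free:
    [f_closing] recovers [x] at [m], and [f_local] gives the two new output cells. *)
Lemma card_right_stairs_succ m : (r <= m)%N ->
  #|right_stairs f m.+1| = (#|right_stairs f m| * #|S| ^ 3)%N.
Proof.
move=> rm; rewrite !right_stairsE.
rewrite -(@card_img_pair _ _ _ (stair f m) (fun x => window 3 x (3 * m)%:Z)).
  apply: card_img_eq => x x'; split=> [e|/stair_eq [e1 e2]].
    have /window_eq e3 := congr1 snd e; have /stair_eq [e1 e2] := congr1 fst e.
    apply/stair_eq.
    have e4 (t : int) : m%:Z <= t < (3 * m.+1)%:Z -> x t = x' t.
      move=> ht; have [tm|tm] := ltP t (3 * m)%:Z; first by apply: e1; lia.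
      by apply: e3; lia.
    split=> t ht; first by apply: e4; lia.
    have [tm|tm] := ltP t (2 * m)%:Z; first by apply: e2; lia.
    by apply: f_local => k hk; apply: e4; lia.
  have xm : x m%:Z = x' m%:Z.
    by apply: f_closing => t ht; [apply: e1|apply: e2]; lia.
  have {}e1 (t : int) : m%:Z <= t < (3 * m.+1)%:Z -> x t = x' t.
    by move=> ht; have [->//|tm] := eqVneq t m%:Z; apply: e1; lia.
  congr pair; last by apply/window_eq => t ht; apply: e1; lia.
  by apply/stair_eq; split=> t ht; [apply: e1|apply: e2]; lia.
move=> x; rewrite -[RHS]card_tuple -[RHS]cardsT.
apply: eq_card => v; rewrite finset.inE finset.in_setT; apply/asboolP.
have [x' [x'v e]] := window_surj x (3 * m)%:Z v; exists x'; split => //.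
apply/stair_eq; split=> t ht; first by apply: e; lia.
by apply: f_local => k hk; apply: e; lia.
Qed.

Hypothesis S_nonempty : (0 < #|S|)%N.

Lemma stair_densityE m n : (r <= m)%N -> (m <= n)%N ->
  stair_density f n = stair_density f m.
Proof.
move=> rm; elim: n => [|n IH]; first by rewrite leqn0 => /eqP ->.
rewrite leq_eqVlt => /orP [/eqP -> //|]; rewrite ltnS => mn.
rewrite -(IH mn) /stair_density card_right_stairs_succ; last exact: leq_trans mn.
have -> : (3 * n.+1 = 3 * n + 3)%N by lia.
rewrite expnD !natrM -mulf_div divff ?mulr1 //.
by rewrite -!natrM pnatr_eq0 -lt0n !muln_gt0 S_nonempty.
Qed.

Lemma lambdaE m : (r <= m)%N -> lambda f = stair_density f m.
Proof.
move=> rm; apply: (@norm_lim_near_cst rat rat^o).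
by exists m => // n /= mn; apply: stair_densityE.
Qed.

Lemma lambda_eq_inv m (k : nat) : (r <= m)%N ->
  lambda f * k%:R = 1 <-> (#|right_stairs f m| * k = #|S| ^ (3 * m))%N.
Proof.
move=> rm; rewrite (lambdaE rm) /stair_density.
have S0 : (#|S| ^ (3 * m))%:R != 0 :> rat.
  by rewrite pnatr_eq0 -lt0n expn_gt0 S_nonempty.
rewrite mulrAC -natrM; split=> [|->]; last by rewrite divff.
by move=> /(canRL (mulfVK S0)); rewrite mul1r => /eqP; rewrite eqr_nat => /eqP.
Qed.

Lemma lambda_neq0 : lambda f != 0.
Proof.
rewrite (lambdaE (leqnn r)) /stair_density mulf_neq0 ?invr_eq0 ?pnatr_eq0 //.
  have /card_gt0P [s _] := S_nonempty.
  rewrite -lt0n; apply/card_gt0P; exists (stair f r (fun _ => s)).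
  by rewrite right_stairsE; apply/imgP; exists (fun _ => s).
by rewrite -lt0n expn_gt0 S_nonempty.
Qed.

Lemma lambda_ge0 : 0 <= lambda f.
Proof. by rewrite (lambdaE (leqnn r)) divr_ge0 ?ler0n. Qed.

End Density.

(** * Valuations and unit fractions *)

Lemma padic_val_inv (x : rat) (k : nat) :
  x * k%:R = 1 -> forall p, padic_val p x <= 0.
Proof.
move=> xk p; suff n1 : absz (numq x) = 1%N by rewrite /padic_val n1 logn1; lia.
(* The numerator divides the denominator, so coprimality leaves only 1. *)
have e : (absz (numq x) * k = absz (denq x))%N.
  have : (numq x)%:~R * k%:R = (denq x)%:~R :> rat.
    by rewrite numqE mulrAC xk mul1r.
  rewrite -[k%:R]/(k%:~R) -intrM => /intr_inj h.
  by rewrite -h abszM.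
have := coprime_num_den x; rewrite -e /coprime.
by rewrite gcdnMr => /eqP.
Qed.

(** A prime factor of the numerator does not divide the denominator, so it would have positive
    valuation; hence the numerator is 1. *)
Lemma padic_val_le0_inv (x : rat) : 0 < x ->
  (forall p, prime p -> padic_val p x <= 0) -> x * (absz (denq x))%:R = 1.
Proof.
move=> x0 h; have n0 : 0 < numq x by rewrite numq_gt0.
have n1 : absz (numq x) = 1%N.
  apply/eqP; apply/negPn/negP => n1.
  have p_pr : prime (pdiv (absz (numq x))) by apply: pdiv_prime; lia.
  set p := pdiv _ in p_pr; have pn : (p %| absz (numq x))%N by apply: pdiv_dvd.
  have := h p p_pr; rewrite /padic_val.
  have : (0 < logn p (absz (numq x)))%N.
    by rewrite logn_gt0 mem_primes p_pr pn andbT; lia.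
  have -> : logn p (absz (denq x)) = 0%N; last by lia.
  apply/eqP; rewrite -leqn0 leqNgt logn_gt0 mem_primes p_pr /=.
  apply/negP => /andP [_ pd].
  have : (p %| gcdn (absz (numq x)) (absz (denq x)))%N by rewrite dvdn_gcd pn.
  rewrite (eqP (coprime_num_den x)) dvdn1 => /eqP p1.
  by rewrite p1 in p_pr.
have e : numq x = 1 by lia.
have den : (absz (denq x))%:Z = denq x by have := denq_gt0 x; lia.
by rewrite -[_%:R]/((absz (denq x))%:Z%:~R) den -numqE e.
Qed.

(** * Block rules as transducers *)

Lemma cvg_config_seqP (S : finType) (u : nat -> config S) (y : config S) :
  (u @ \oo --> y) <->
  (forall k, exists N, forall n, (N <= n)%N -> u n k = y k).
Proof.
have P := @cvg_configP S (u @ \oo) y _.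
split=> [/P h k|h]; first by have [N _ hN] := h k; exists N => n; apply: hN.
by apply/P => k; have [N hN] := h k; exists N.
Qed.

Lemma cvg_config_unique (S : finType) (u : nat -> config S) (y y' : config S) :
  u @ \oo --> y ->
  (forall k, exists N, forall n, (N <= n)%N -> u n k = y' k) -> y = y'.
Proof.
move=> /cvg_config_seqP h h'; apply/funext => k.
have [N hN] := h k; have [N' hN'] := h' k.
by rewrite -(hN (maxn N N')) ?(hN' (maxn N N')) // ?leq_maxl ?leq_maxr.
Qed.

(** Before a step the block holds the state followed by the letter to be read, afterwards the letter
    written followed by the next state; hence two splittings of a block. *)
Definition rcons_t (S : finType) (d : nat) (p : d.-tuple S * S) :
  d.+1.-tuple S := [tuple of rcons p.1 p.2].

Definition unrcons_t (S : finType) (d : nat) (t : d.+1.-tuple S) :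
  d.-tuple S * S := ([tuple of belast (thead t) (behead t)],
                     last (thead t) (behead t)).

Definition cons_t (S : finType) (d : nat) (p : S * d.-tuple S) :
  d.+1.-tuple S := [tuple of p.1 :: p.2].

Definition uncons_t (S : finType) (d : nat) (t : d.+1.-tuple S) :
  S * d.-tuple S := (thead t, [tuple of behead t]).

Lemma cons_tK (S : finType) (d : nat) : cancel (@cons_t S d) (@uncons_t S d).
Proof. by move=> [b q]; congr pair; apply/val_inj. Qed.

Lemma uncons_tK (S : finType) (d : nat) : cancel (@uncons_t S d) (@cons_t S d).
Proof. by move=> t; rewrite [RHS]tuple_eta; apply/val_inj. Qed.

Lemma unrcons_tK (S : finType) (d : nat) :
  cancel (@unrcons_t S d) (@rcons_t S d).
Proof.
by move=> t; apply/val_inj => /=; rewrite -lastI [in RHS](tuple_eta t).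
Qed.

Lemma rcons_tK (S : finType) (d : nat) :
  cancel (@rcons_t S d) (@unrcons_t S d).
Proof.
move=> p; have : rcons_t (unrcons_t (rcons_t p)) = rcons_t p by rewrite unrcons_tK.
case: p (unrcons_t _) => q a [q' a'] /(congr1 val) /= /rcons_inj [e ->].
by congr pair; apply: val_inj.
Qed.

Lemma apply_at_eq (S : finType) (m : nat) (chi : m.-tuple S -> m.-tuple S)
    (i : int) (x x' : config S) :
  window m x' i = chi (window m x i) ->
  (forall t : int, ~~ (i <= t < i + m%:Z) -> x' t = x t) ->
  apply_at chi i x = x'.
Proof.
move=> e e'; apply/funext => k; rewrite /apply_at.
case: ifPn => [ik|/e' //]; rewrite -e.
have km : (absz (k - i)%R < m)%N by lia.
rewrite -[LHS]/(nth (x k : S) (window m x' i) (Ordinal km)) -tnth_nth tnth_mktuple /=.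
by congr (x' _); lia.
Qed.

Section SliderRuns.
Context (S Q : finType) (d : nat) (delta : Q * S -> S * Q)
  (gamma : S * Q -> Q * S) (chi xi : d.+1.-tuple S -> d.+1.-tuple S)
  (enc : Q -> d.-tuple S) (dec : d.-tuple S -> Q).
Hypothesis deltaK : cancel delta gamma.
Hypothesis gammaK : cancel gamma delta.
Hypothesis chiK : cancel chi xi.
Hypothesis decK : cancel dec enc.
Hypothesis chiE : forall q a, chi (rcons_t (enc q, a)) =
  cons_t ((delta (q, a)).1, enc (delta (q, a)).2).

(* The configuration reached when the block rule has swept up to cell j. *)
Definition swept (q : int -> Q) (y z : config S) (j : int) : config S :=
  fun k => if k < j then z k else
    if k < j + d%:Z then nth (y k : S) (enc (q j)) (absz (k - j)%R) else y k.

Lemma window_swept q y z j :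
  window d.+1 (swept q y z j) j = rcons_t (enc (q j), y (j + d%:Z)).
Proof.
apply/eq_from_tnth => k; rewrite tnth_mktuple (tnth_nth (y (j + k%:Z) : S)) /=.
rewrite nth_rcons size_tuple /swept.
have -> : (j + k%:Z < j) = false by lia.
have -> : absz (j + k%:Z - j)%R = k by lia.
case: (ltnP k d) => kd; first by have -> : j + k%:Z < j + d%:Z by lia.
have kd' : k = d :> nat by have := ltn_ord k; lia.
by rewrite kd' eqxx ltxx.
Qed.

Lemma window_swept_next q y z j :
  window d.+1 (swept q y z (j + 1)) j = cons_t (z j, enc (q (j + 1))).
Proof.
apply/eq_from_tnth => k; rewrite tnth_mktuple (tnth_nth (y (j + k%:Z) : S)) /swept.
case: k => -[|k] kd /=; first by rewrite addr0 ltrDl.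
have -> : (j + k.+1%:Z < j + 1) = false by lia.
have -> : j + k.+1%:Z < j + 1 + d%:Z by lia.
by congr nth; lia.
Qed.

Section OneRun.
Context (q : int -> Q) (y z : config S).
Hypothesis qrun : run delta d q y z.

Lemma apply_at_swept j :
  apply_at chi j (swept q y z j) = swept q y z (j + 1).
Proof.
apply: apply_at_eq; first by rewrite window_swept window_swept_next chiE qrun.
move=> t ht; rewrite /swept; case: (ltP t j) => tj.
  by have -> : t < j + 1 by lia.
have -> : (t < j + 1) = false by lia.
have -> : (t < j + 1 + d%:Z) = false by lia.
by have -> : (t < j + d%:Z) = false by lia.
Qed.

Lemma apply_at_swept_inv j :
  apply_at xi j (swept q y z (j + 1)) = swept q y z j.
Proof.
apply: apply_at_eq.
  by rewrite window_swept window_swept_next -[LHS]chiK chiE qrun.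
move=> t ht; rewrite -apply_at_swept /apply_at.
by move: ht; case: ifP => //.
Qed.

Lemma right_sweep_swept i n :
  right_sweep chi i n (swept q y z i) = swept q y z (i + n.+1%:Z).
Proof.
elim: n => [|n IH] /=; first by rewrite apply_at_swept.
by rewrite IH apply_at_swept; congr swept; lia.
Qed.

Lemma left_sweep_swept i n :
  left_sweep xi i n (swept q y z i) = swept q y z (i - n.+1%:Z).
Proof.
elim: n => [|n IH] /=.
  by rewrite -[in LHS](subrK 1 i) addrK apply_at_swept_inv.
rewrite IH; have -> : i - n.+1%:Z = i - 1 - n.+1%:Z + 1 by lia.
by rewrite apply_at_swept_inv; congr swept; lia.
Qed.

Lemma right_sweep_lim i k : exists N, forall n, (N <= n)%N ->
  right_sweep chi i n (swept q y z i) k = z k.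
Proof.
exists (absz (k - i)%R) => n hn; rewrite right_sweep_swept /swept.
by have -> : k < i + n.+1%:Z by lia.
Qed.

Lemma left_sweep_lim i k : exists N, forall n, (N <= n)%N ->
  left_sweep xi i n (swept q y z i) k = y k.
Proof.
exists (absz (k - i)%R + d)%N => n hn; rewrite left_sweep_swept /swept.
have -> : (k < i - n.+1%:Z) = false by lia.
by have -> : (k < i - n.+1%:Z + d%:Z) = false by lia.
Qed.

End OneRun.

(** The cells [[i, i + d)] of [x] hold a state; spliced with [x] as past output and future input it
    gives a run whose swept configuration at [i] is [x]. The two sweeps of [x] then converge to the
    input and the output of that run. *)
Lemma slider_relationP y z :
  slider_relation chi xi y z <-> exists q, run delta d q y z.
Proof.
split=> [[x [i [cy cz]]]|[q qrun]].
  have [q [y' [z' [qrun qi hz hy]]]] :=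
    run_splice d gammaK i (dec (window d x i)) x x.
  have ex : swept q y' z' i = x.
    apply/funext => k; rewrite /swept; case: ltP => ki; first exact: hz.
    case: ltP => kid; last exact: hy.
    have kd : (absz (k - i)%R < d)%N by lia.
    rewrite qi decK -[LHS]/(nth (y' k : S) (window d x i) (Ordinal kd)).
    rewrite -tnth_nth tnth_mktuple /=; congr x; lia.
  rewrite -ex in cy cz; exists q.
  rewrite (cvg_config_unique cy (left_sweep_lim qrun i)).
  by rewrite (cvg_config_unique cz (right_sweep_lim qrun i)).
exists (swept q y z 0), 0.
split; apply/cvg_config_seqP; first exact: left_sweep_lim.
exact: right_sweep_lim.
Qed.

End SliderRuns.

(** * The transducer of a left-closing automaton *)

Section StairTransducer.
Context (S : finType) (f : config S -> config S) (r m : nat).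
Hypothesis f_shift : forall x, f (shift x) = shift (f x).
Hypothesis f_local : local_map r f.
Hypothesis f_closing : closing_range r f.
Hypothesis rm : (r <= m)%N.
Hypothesis S_nonempty : (0 < #|S|)%N.

Definition stair_state := {vw | vw \in right_stairs f m}.

Lemma stair_in x : stair f m x \in right_stairs f m.
Proof. by rewrite right_stairsE; apply/imgP; exists x. Qed.

Definition state_of (x : config S) : stair_state := exist _ (stair f m x) (stair_in x).

Lemma state_of_eq x x' :
  state_of x = state_of x' <-> stair f m x = stair f m x'.
Proof. by split=> [/(congr1 val)|e] //; apply: val_inj. Qed.

Definition stair_input (x : config S) : stair_state * S :=
  (state_of x, x (3 * m)%:Z).
Definition stair_output (x : config S) : S * stair_state :=
  (f x 0, state_of (shift x)).

(** Since [r <= m], changing cell [3m] leaves [f x] unchanged on [[0, 2m)]. *)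
Lemma stair_input_surj t : exists x, stair_input x = t.
Proof.
case: t => -[vw vwP] a.
have /imgP [x xvw] : vw \in img (stair f m) by rewrite -right_stairsE.
exists (fun t => if t == (3 * m)%:Z then a else x t).
rewrite /stair_input eqxx; congr pair; apply: val_inj => /=; rewrite -xvw.
apply/stair_eq; split=> t ht; first by case: eqP => //; lia.
by apply: f_local => k hk; case: eqP => //; lia.
Qed.

(** Both sides fix [x] on [[m, 3m]] and [f x] on [[0, 2m]]: the input lacks only [f x] at [2m],
    given by [f_local], and the output only [x] at [m], given by [f_closing]. *)
Lemma stair_output_eq x x' :
  stair_input x = stair_input x' <-> stair_output x = stair_output x'.
Proof.
split=> e.
  have /state_of_eq/stair_eq [e1 e2] := congr1 fst e.
  have {e} e3 := congr1 snd e.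
  have {}e1 (t : int) : m%:Z <= t <= (3 * m)%:Z -> x t = x' t.
    by move=> ht; have [->//|tm] := eqVneq t (3 * m)%:Z; apply: e1; lia.
  have e4 : f x (2 * m)%:Z = f x' (2 * m)%:Z.
    by apply: f_local => k hk; apply: e1; lia.
  have {}e2 (t : int) : 0 <= t <= (2 * m)%:Z -> f x t = f x' t.
    by move=> ht; have [->//|tm] := eqVneq t (2 * m)%:Z; apply: e2; lia.
  congr pair; first by apply: e2.
  apply/state_of_eq/stair_eq; rewrite !f_shift.
  by split=> t ht; [apply: e1|apply: e2]; lia.
have /state_of_eq/stair_eq [e1 e2] := congr1 snd e.
have {e} e3 := congr1 fst e; rewrite !f_shift in e2.
have {}e1 (t : int) : m%:Z < t <= (3 * m)%:Z -> x t = x' t.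
  by move=> ht; have := e1 (t - 1); rewrite /shift subrK; apply; lia.
have {}e2 (t : int) : 0 <= t <= (2 * m)%:Z -> f x t = f x' t.
  move=> ht; have [->//|t0] := eqVneq t 0.
  by have := e2 (t - 1); rewrite /shift subrK; apply; lia.
have e4 : x m%:Z = x' m%:Z.
  by apply: f_closing => t ht; [apply: e1|apply: e2]; lia.
have {}e1 (t : int) : m%:Z <= t <= (3 * m)%:Z -> x t = x' t.
  by move=> ht; have [->//|tm] := eqVneq t m%:Z; apply: e1; lia.
congr pair; last by apply: e1; lia.
by apply/state_of_eq/stair_eq; split=> t ht; [apply: e1|apply: e2]; lia.
Qed.

(** Composed with a section of [stair_input], [stair_output] is an injection between finite sets of
    equal size. *)
Lemma stair_transducer : exists (delta : stair_state * S -> S * stair_state)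
    (gamma : S * stair_state -> stair_state * S),
  [/\ cancel delta gamma, cancel gamma delta &
      forall x, delta (stair_input x) = stair_output x].
Proof.
have [g hg] := choice stair_input_surj.
have dE x : stair_output (g (stair_input x)) = stair_output x.
  by apply/stair_output_eq; rewrite hg.
have inj : injective (stair_output \o g).
  by move=> t t' /= /stair_output_eq; rewrite !hg.
have [gamma h1 h2] : bijective (stair_output \o g).
  by apply: inj_card_bij => //; rewrite !card_prod mulnC.
by exists (stair_output \o g), gamma.
Qed.

(** Each state is the stair of some [x j], and consecutive stairs overlap; so, up to a shift by [j],
    [x j] is [y] on [[m, 3m]] and [f (x j)] is [z] on [[0, 2m]]. *)
Lemma stair_run_fun (delta : stair_state * S -> S * stair_state) q y z :
  (forall x, delta (stair_input x) = stair_output x) ->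
  run delta (3 * m) q y z -> z = f y.
Proof.
move=> dE qrun.
have /choice [x hx] : forall j, exists x, stair_input x = (q j, y (j + (3 * m)%:Z)).
  by move=> j; apply: stair_input_surj.
have out j : stair_output (x j) = (z j, q (j + 1)) by rewrite -dE hx qrun.
have ey j : x j (3 * m)%:Z = y (j + (3 * m)%:Z) by have := congr1 snd (hx j).
have ez j : f (x j) 0 = z j by have := congr1 fst (out j).
have /= next j : stair f m (shift (x j)) = stair f m (x (j + 1)).
  apply/state_of_eq; rewrite -[LHS]/(stair_output (x j)).2 out.
  by rewrite -[RHS]/(stair_input (x (j + 1))).1 hx.
have nexty j (t : int) : m%:Z <= t < (3 * m)%:Z -> x j (t + 1) = x (j + 1) t.
  by have /stair_eq [h _] := next j; apply: h.
have nextz j (t : int) : 0 <= t < (2 * m)%:Z -> f (x j) (t + 1) = f (x (j + 1)) t.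
  by have /stair_eq [_ h] := next j; rewrite f_shift in h; apply: h.
have xy j (t : int) : m%:Z <= t <= (3 * m)%:Z -> x j t = y (j + t).
  move=> ht; have [n e] : exists n : nat, t = (3 * m)%:Z - n%:Z.
    by exists (absz ((3 * m)%:Z - t)%R); lia.
  elim: n t j e ht => [|n IH] t j e ht; first by rewrite e subr0.
  have := nexty (j - 1) t; rewrite subrK => <-; last by lia.
  rewrite IH; [congr y|..]; lia.
have fz j (t : int) : 0 <= t <= (2 * m)%:Z -> f (x j) t = z (j + t).
  move=> ht; have [n e] : exists n : nat, t = n%:Z by exists (absz t); lia.
  elim: n t j e ht => [|n IH] t j e ht; first by rewrite e addr0.
  have := nextz j (t - 1); rewrite subrK => ->; last by lia.
  rewrite IH; [congr z|..]; lia.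
(* At cell [2m] the value of [f (x j)] depends only on [[m, 3m]], where [x j] is known. *)
apply/funext => i; pose j := i - (2 * m)%:Z.
have -> : f y i = f (translate j y) (2 * m)%:Z.
  by rewrite translate_commute // /translate /j; congr (f y); lia.
have -> : z i = f (x j) (2 * m)%:Z by rewrite fz /j; [congr z|]; lia.
by apply: f_local => t ht; rewrite xy /translate; [congr y|]; lia.
Qed.

Lemma stair_run (delta : stair_state * S -> S * stair_state) y :
  (forall x, delta (stair_input x) = stair_output x) ->
  run delta (3 * m) (fun j => state_of (translate j y)) y (f y).
Proof.
move=> dE j; have := dE (translate j y); rewrite /stair_input /stair_output.
rewrite translate_commute // {2}/translate addrC => ->.
congr (_, _); first by rewrite /translate add0r.
congr state_of; apply/funext => t; rewrite /shift /translate; congr y; lia.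
Qed.

Lemma stair_slider (k : nat) :
  (#|right_stairs f m| * k = #|S| ^ (3 * m))%N -> slider f.
Proof.
move=> card_k; pose d := (3 * m)%N.
have k0 : (0 < k)%N.
  have : (0 < #|S| ^ (3 * m))%N by rewrite expn_gt0 S_nonempty.
  by rewrite -card_k muln_gt0 => /andP [].
pose Q := (stair_state * 'I_k)%type.
(* Equal cardinals allow the states to be encoded bijectively by words, through enumeration
   ranks. *)
have cardQ : #|{: Q}| = #|{: d.-tuple S}|.
  by rewrite card_prod card_ord card_sig card_tuple -card_k.
pose enc (q : Q) : d.-tuple S := enum_val (cast_ord cardQ (enum_rank q)).
pose dec (t : d.-tuple S) : Q := enum_val (cast_ord (esym cardQ) (enum_rank t)).
have encK : cancel enc dec.
  by move=> q; rewrite /dec enum_valK cast_ordK enum_rankK.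
have decK : cancel dec enc.
  by move=> q; rewrite /enc enum_valK cast_ordKV enum_rankK.
have [delta [gamma [dK gK dE]]] := stair_transducer.
pose delta' (p : Q * S) : S * Q :=
  let t := delta (p.1.1, p.2) in (t.1, (t.2, p.1.2)).
pose gamma' (p : S * Q) : Q * S :=
  let t := gamma (p.1, p.2.1) in ((t.1, p.2.2), t.2).
have dK' : cancel delta' gamma'.
  by move=> [[q c] a]; rewrite /gamma' /= -surjective_pairing dK.
have gK' : cancel gamma' delta'.
  by move=> [b [q c]]; rewrite /delta' /= -surjective_pairing gK.
pose enc_in (p : Q * S) := (enc p.1, p.2).
pose dec_in (p : d.-tuple S * S) := (dec p.1, p.2).
pose enc_out (p : S * Q) := (p.1, enc p.2).
pose dec_out (p : S * d.-tuple S) := (p.1, dec p.2).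
have enc_inK : cancel enc_in dec_in.
  by move=> [q a]; rewrite /dec_in /enc_in encK.
have dec_inK : cancel dec_in enc_in.
  by move=> [q a]; rewrite /dec_in /enc_in decK.
have enc_outK : cancel enc_out dec_out.
  by move=> [q a]; rewrite /dec_out /enc_out encK.
have dec_outK : cancel dec_out enc_out.
  by move=> [q a]; rewrite /dec_out /enc_out decK.
pose chi (t : d.+1.-tuple S) : d.+1.-tuple S :=
  cons_t (enc_out (delta' (dec_in (unrcons_t t)))).
pose xi (t : d.+1.-tuple S) : d.+1.-tuple S :=
  rcons_t (enc_in (gamma' (dec_out (uncons_t t)))).
have chiK : cancel chi xi.
  by move=> t; rewrite /xi cons_tK enc_outK dK' dec_inK unrcons_tK.
have xiK : cancel xi chi.
  by move=> t; rewrite /chi rcons_tK enc_inK gK' dec_outK uncons_tK.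
have chiE q a : chi (rcons_t (enc q, a)) =
    cons_t ((delta' (q, a)).1, enc (delta' (q, a)).2).
  by rewrite /chi rcons_tK (enc_inK (q, a)).
exists d.+1, chi, xi; split => // y z.
rewrite (slider_relationP gK' chiK decK chiE); split=> [[q qrun]|->].
  apply: (stair_run_fun (q := fun j => (q j).1) dE) => j; have := qrun j.
  rewrite /delta' /= -/d; case: (delta _) => b q' /= [-> e].
  by rewrite -e.
exists (fun j => (state_of (translate j y), Ordinal k0)) => j.
by rewrite /delta' /= stair_run.
Qed.

End StairTransducer.

(** * Sliders as transducers, and the characterisation *)

Lemma slider_transducer (S : finType) (f : config S -> config S) :
  slider f -> exists (d : nat) (delta : d.-tuple S * S -> S * d.-tuple S)
    (gamma : S * d.-tuple S -> d.-tuple S * S),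
  [/\ cancel delta gamma, cancel gamma delta,
      forall q y z, run delta d q y z -> z = f y &
      forall y, exists q, run delta d q y (f y)].
Proof.
move=> [[|d] [chi [xi [m0 chiK xiK sl]]]]; first by [].
(* The states are the words of length [d] themselves, encoded by the identity. *)
pose delta (p : d.-tuple S * S) : S * d.-tuple S := uncons_t (chi (rcons_t p)).
pose gamma (p : S * d.-tuple S) : d.-tuple S * S := unrcons_t (xi (cons_t p)).
have dK : cancel delta gamma.
  by move=> p; rewrite /gamma /delta uncons_tK chiK rcons_tK.
have gK : cancel gamma delta.
  by move=> p; rewrite /gamma /delta unrcons_tK xiK cons_tK.
have chiE (q : d.-tuple S) (a : S) : chi (rcons_t (id q, a)) =
    cons_t ((delta (q, a)).1, id (delta (q, a)).2).
  by rewrite -[LHS]uncons_tK; congr cons_t; exact: surjective_pairing.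
have decK : cancel (@id (d.-tuple S)) id by [].
exists d, delta, gamma; split => // [q y z qrun|y].
  by apply/sl; apply/(slider_relationP gK chiK decK chiE); exists q.
by apply/(slider_relationP gK chiK decK chiE)/sl.
Qed.

Theorem theorem20 (S : finType) (S_nonempty : (0 < #|S|)%N)
    (f : config S -> config S) :
  slider f <->
  [/\ cellular_automaton f, left_closing f
    & forall p : nat, prime p -> padic_val p (lambda f) <= 0].
Proof.
have range : cellular_automaton f -> left_closing f ->
    exists r, local_map r f /\ closing_range r f.
  move=> ca lc; have [r1 h1] := cellular_automaton_local ca.
  have [r2 h2] := left_closing_range ca lc; exists (maxn r1 r2); split.
    by apply: local_mapW h1; rewrite leq_maxl.
  by apply: closing_rangeW h2; rewrite leq_maxr.
split=> [/slider_transducer [d [delta [gamma [dK gK rf rt]]]]|[ca lc padic]].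
  have ca := run_fun_cellular_automaton rf rt.
  have lc := run_fun_left_closing dK gK rf rt.
  split => // p _; have [r [f_local f_closing]] := range ca lc.
  have /card_gt0P [s _] := S_nonempty.
  pose x0 : config S := fun _ => s; pose m := (r + d)%N.
  (* [lambda f] is the inverse of the number of states over any input. *)
  apply: (@padic_val_inv _ #|states_at delta d f x0 0|).
  apply/(lambda_eq_inv f_local f_closing S_nonempty (m := m)).
    by rewrite leq_addr.
  apply: (card_right_stairs_run dK gK rf rt f_local x0 (card_tuple d S)) => //.
  by move=> y j; apply: (card_states_const dK gK rf rt f_local).
have [r [f_local f_closing]] := range ca lc; case: ca => _ f_shift.
(* The valuations force numerator 1, so [k] is the denominator of [lambda f]. *)
apply: (stair_slider f_shift f_local f_closing (leqnn r) S_nonempty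
  (k := absz (denq (lambda f)))).
apply/(lambda_eq_inv f_local f_closing S_nonempty _ (leqnn r)).
apply: padic_val_le0_inv padic.
rewrite lt_def (lambda_neq0 f_local f_closing S_nonempty).
exact: (lambda_ge0 f_local f_closing S_nonempty).
Qed.
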